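(* For $n\ge1$, let $s_n^2(123)=|\{\pi\in\mathfrak{S}_n(123):\mathrm{fp}(\pi)=2\}|$. Then $$s_n^2(123)=\sum_{i=1}^{n-1}\sum_{r,s=1}^{i}\left[\left(\binom{2i-r-1}{i-1}-\binom{2i-r-1}{i}\right)\left(\binom{2i-s-1}{i-1}-\binom{2i-s-1}{i}\right)\cdot\sum_{\substack{h=1\\ n-h\ \text{even}}}^{n}\sum_{k=0}^{n-2i} f(k,r,h,n-2i+r)\, f(n-2i-k,s,h,n-2i+s)\right],$$ where $$f(k,r,h,\ell)=\begin{cases}\binom{\frac{\ell+h-r}{2}-1}{k}\binom{\frac{\ell-h+r}{2}-1}{k-1}-\binom{\frac{\ell-h-r}{2}-1}{k}\binom{\frac{\ell+h+r}{2}-1}{k-1} & \text{if } k\ge1,\\ 1 & \text{if } k=0 \text{ and } \ell=h-r,\\ 0&\text{otherwise,}\end{cases}$$ with the convention $\binom{a}{b}=0$ if $a<0$.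
   Context: For permutations $\pi=\pi_1\cdots\pi_n\in\mathfrak{S}_n$ and $\sigma\in\mathfrak{S}_m$, $\pi$ contains $\sigma$ if there are indices $i_1<\dots<i_m$ such that $\pi_{i_1}\cdots\pi_{i_m}$ is in the same relative order as $\sigma$; otherwise $\pi$ avoids $\sigma$. $\mathfrak{S}_n(123)$ is the set of $123$-avoiding permutations in $\mathfrak{S}_n$. $\mathrm{fp}(\pi)=|\{i:\pi_i=i\}|$. *)

(* Defs.v *)
From mathcomp Require Import all_boot all_order all_fingroup all_algebra.
Set Implicit Arguments.
Unset Strict Implicit.
Unset Printing Implicit Defensive.
Import Order.TTheory GRing.Theory Num.Theory.
Local Open Scope ring_scope.

(* Permutations act on {0, ..., n-1}; this shifts positions and values of the
   usual one-line notation by one, which changes neither relative orders nor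
   the number of fixed points. *)
Definition contains_pattern (m n : nat) (sigma : 'S_m) (pi : 'S_n) : bool :=
  [exists e : {ffun 'I_m -> 'I_n},
    [forall a : 'I_m, forall b : 'I_m, (a < b)%N ==> (e a < e b)%N] &&
    [forall a : 'I_m, forall b : 'I_m,
       (pi (e a) < pi (e b))%N == (sigma a < sigma b)%N]].

Definition avoids (m n : nat) (sigma : 'S_m) (pi : 'S_n) : bool :=
  ~~ contains_pattern sigma pi.

(* The pattern 123 is the identity permutation of three letters. *)
Definition pattern123 : 'S_3 := 1%g.

Definition fp (n : nat) (pi : 'S_n) : nat := #|[set i | pi i == i]|.

Definition s2_123 (n : nat) : nat :=
  #|[set pi : 'S_n | avoids pattern123 pi & fp pi == 2%N]|.

Definition binz (a b : int) : int :=
  match a, b with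
  | Posz m, Posz k => ('C(m, k))%:Z
  | _, _ => 0
  end.

(* All the halves are exact divisions when l + h + r is even, which holds for
   l = n - 2i + r and n - h even. *)
Definition f (k r h l : int) : int :=
  if 1 <= k then
    binz (((l + h - r) %/ 2)%Z - 1) k
      * binz (((l - h + r) %/ 2)%Z - 1) (k - 1)
    - binz (((l - h - r) %/ 2)%Z - 1) k
      * binz (((l + h + r) %/ 2)%Z - 1) (k - 1)
  else if (k == 0) && (l == h - r) then 1
  else 0.

(* Main.v *)
(* In a 123-avoiding permutation the left-to-right minima and the other entries
   both decrease, so with two fixed points a < b the first is a left-to-right
   minimum and the second is not.  Follow the boundary of the left-to-right minima
   from the top-left to the bottom-right corner, an up step reading the next
   largest value and a down step the next position; minima are the peaks, and the
   remaining values and positions are matched first in, first out.  The fixed point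
   a puts a peak on the main diagonal, so the Dyck path splits there into A and the
   reversal of B, both of length n and of final height h.  The fixed point b is the
   value of the i-th up step of A and the position of the i-th up step of B, where
   i counts the values >= b; neither step is in a peak, and the matching rule says
   that together A and B have n - 2i peaks after their i-th up steps, the central
   one excepted.  With r and s the heights after these steps, ballot numbers count
   the initial parts and f counts the final parts by peaks. *)
Require Import Defs.
From mathcomp Require Import all_boot all_order all_fingroup all_algebra zify.
Import Order.TTheory GRing.Theory Num.Theory.

Set Implicit Arguments.
Unset Strict Implicit.
Unset Printing Implicit Defensive.

(** * Words of up (true) and down (false) steps *)

Fixpoint words (N : nat) : seq (seq bool) :=
  if N is N'.+1 then
    [seq true :: w | w <- words N'] ++ [seq false :: w | w <- words N']
  else [:: [::]].

Lemma mem_words N w : (w \in words N) = (size w == N).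
Proof.
elim: N w => [|N IH] [|x w] //=; rewrite mem_cat.
  by apply/negP => /orP[] /mapP[].
have inj (b : bool) : injective (cons b) by move=> ? ? [].
case: x; rewrite (mem_map (inj _)) IH eqSS.
  by apply/orP/idP => [[]// /mapP[]//|]; left.
by apply/orP/idP => [[]// /mapP[]//|]; right.
Qed.

Lemma words_uniq N : uniq (words N).
Proof.
elim: N => //= N IH; rewrite cat_uniq !map_inj_uniq ?IH; try by move=> ? ? [].
rewrite andbT /=; apply/hasPn => w /mapP[v _ ->]; apply/negP => /mapP[] //.
Qed.

Lemma sum_words_cat M N (F : seq bool -> nat) :
  \sum_(w <- words (M + N)) F w =
  \sum_(u <- words M) \sum_(v <- words N) F (u ++ v).
Proof.
elim: M F => [|M IH] F; first by rewrite big_seq1.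
by rewrite addSn /= !big_cat !big_map /= !IH.
Qed.

(** The mirror image of a path: read backwards, each step changes its direction. *)
Definition revneg (w : seq bool) : seq bool := rev (map negb w).

Lemma revnegK : involutive revneg.
Proof.
by move=> w; rewrite /revneg map_rev revK -map_comp map_id_in // => x _ /=; rewrite negbK.
Qed.

Lemma size_revneg w : size (revneg w) = size w.
Proof. by rewrite size_rev size_map. Qed.

Lemma revneg_cat u v : revneg (u ++ v) = revneg v ++ revneg u.
Proof. by rewrite /revneg map_cat rev_cat. Qed.

Lemma revneg_cons x w : revneg (x :: w) = rcons (revneg w) (~~ x).
Proof. by rewrite /revneg /= rev_cons. Qed.

Lemma sum_words_revneg N (F : seq bool -> nat) :
  \sum_(w <- words N) F w = \sum_(w <- words N) F (revneg w).
Proof.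
rewrite -(big_map revneg xpredT F); apply: perm_big; apply: uniq_perm.
- exact: words_uniq.
- by rewrite map_inj_uniq ?words_uniq //; apply: inv_inj revnegK.
- move=> w; rewrite -{2}[w]revnegK mem_map ?mem_words ?size_revneg //.
  exact: inv_inj revnegK.
Qed.

Notation cU w := (count (@id bool) w).
Notation cD w := (count negb w).

Lemma count_UD w : cU w + cD w = size w.
Proof. by elim: w => //= -[] w <- /=; lia. Qed.

Lemma cU_revneg w : cU (revneg w) = cD w.
Proof. by rewrite /revneg count_rev count_map; apply: eq_count => -[]. Qed.

Lemma cD_revneg w : cD (revneg w) = cU w.
Proof. by rewrite /revneg count_rev count_map; apply: eq_count => -[]. Qed.

Fixpoint nonneg (h : nat) (w : seq bool) : bool :=
  if w is x :: w' then
    if x then nonneg h.+1 w' else (0 < h) && nonneg h.-1 w'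
  else true.

Definition pathto (h : nat) (w : seq bool) (e : nat) : bool :=
  nonneg h w && (h + cU w == e + cD w).

Lemma pathto_U h w e : pathto h (true :: w) e = pathto h.+1 w e.
Proof. by rewrite /pathto /= addnCA !addnA add1n. Qed.

Lemma pathto_D h w e : pathto h.+1 (false :: w) e = pathto h w e.
Proof. by rewrite /pathto /= add0n addSn add1n addnS eqSS. Qed.

Lemma nonneg_bound h w : nonneg h w -> cD w <= h + cU w.
Proof.
elim: w h => [|[] w IH] h //=; first by move/IH => LE; lia.
by case/andP=> h0 /IH LE; lia.
Qed.

(** If [u] goes below 0, both sides are false; otherwise [nonneg_bound] makes the truncated
    subtraction exact. *)
Lemma nonneg_cat h u v :
  nonneg h (u ++ v) = nonneg h u && nonneg (h + cU u - cD u) v.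
Proof.
elim: u h => [|[] u IH] h /=; first by rewrite addn0 subn0.
  by rewrite IH; congr (_ && nonneg _ _); lia.
rewrite IH -andbA; case: h => //= h; congr (_ && nonneg _ _); lia.
Qed.

Lemma pathto_revneg h w e : pathto h (revneg w) e = pathto e w h.
Proof.
rewrite /pathto cU_revneg cD_revneg.
elim: w h e => [|x w IH] h e /=; first by rewrite /= !addn0 eq_sym.
rewrite revneg_cons -cats1 nonneg_cat cU_revneg cD_revneg; case: x => /=.
  have := IH h e.+1; rewrite !add0n !add1n !addSn !addnS eq_sym; lia.
case: e => [|e] /=.
  apply/negP => /andP[/andP[/nonneg_bound]]; rewrite cU_revneg cD_revneg; lia.
have := IH h e; rewrite !andbT; lia.
Qed.

(** Both halves are read from their outer ends towards the cut, so the only joint condition is a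
    common final height, written with sums to avoid subtraction. *)
Lemma pathto_cat_revneg A B :
  pathto 0 (A ++ revneg B) 0 =
  [&& nonneg 0 A, nonneg 0 B & cU A + cD B == cU B + cD A].
Proof.
have E := pathto_revneg (cU A - cD A) B 0.
rewrite /pathto nonneg_cat !count_cat !cU_revneg !cD_revneg.
case nA: (nonneg 0 A) => //=; have := nonneg_bound nA.
move: E; rewrite /pathto cU_revneg cD_revneg !add0n => E LE.
have -> : (cU A + cD B == cD A + cU B) = (cU A - cD A + cD B == cU B) by lia.
rewrite E; congr (_ && _); lia.
Qed.

(** * 123-avoiding lists and Dyck words *)

(* Reads a suffix of a Dyck word: y values are still unread, p tells whether value
   y has just been read by an up step, and Q holds the other pending values. A down
   step outputs y after an up step and the head of Q otherwise. *)
Fixpoint run (p : bool) (Q : seq nat) (y : nat) (w : seq bool) : seq nat :=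
  match w with
  | [::] => [::]
  | true :: w' => run true (if p then rcons Q y else Q) y.-1 w'
  | false :: w' =>
    if p then y :: run false Q y w' else head 0 Q :: run false (behead Q) y w'
  end.

Fixpoint av123 (s : seq nat) : bool :=
  if s is x :: s' then sorted gtn (filter (ltn x) s') && av123 s' else true.

(* The lists that [run p Q y] can produce. *)
Record fits (p : bool) (Q : seq nat) (y : nat) (s : seq nat) : Prop := Fits {
  fits_uniq : uniq s;
  fits_low : forall x, x < y + p -> x \in s;
  fits_queue : filter (leq (y + p)) s = Q;
  fits_av : av123 s;
  fits_head : p -> head 0 s <= y }.

Lemma gtn_trans : transitive gtn.
Proof. by move=> a b c /= ba cb; apply: ltn_trans cb ba. Qed.

Lemma queue_rcons (y : nat) Q :
  sorted gtn Q -> all (ltn y) Q -> sorted gtn (rcons Q y).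
Proof.
by rewrite !(sorted_pairwise gtn_trans) pairwise_rcons => -> aQ; rewrite andbT.
Qed.

(** When a peak outputs [y], the later entries above [y] are those of the queue, which is
    decreasing; when the head of the queue is output, it exceeds all later entries. So no entry
    starts a 123 pattern. *)
Lemma run_fits (p : bool) Q y w :
  pathto (size Q + p) w 0 -> cU w = y -> sorted gtn Q -> all (leq (y + p)) Q ->
  fits p Q y (run p Q y w).
Proof.
elim: w p Q y => [|[] w IH] p Q y.
- rewrite /pathto /= => H <- _ _; case: p H; case: Q => //= _.
- move=> H /= cw sQ aQ; case: y cw aQ => // y [cw] aQ /=.
  have H' : pathto (size (if p then rcons Q y.+1 else Q) + true) w 0.
    by move: H; rewrite pathto_U; case: (p); rewrite ?size_rcons ?addn1 ?addn0.
  have sQ' : sorted gtn (if p then rcons Q y.+1 else Q).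
    case: p aQ {H H'} => // aQ; apply: queue_rcons => //.
    by apply: sub_all aQ => x /=; lia.
  have aQ' : all (leq (y + true)) (if p then rcons Q y.+1 else Q).
    case: p aQ {H H' sQ'} => aQ; rewrite ?all_rcons ?addn1 ?leqnn /=;
      by apply: sub_all aQ => x /=; lia.
  have [u l q a h] := IH _ _ _ H' cw sQ' aQ'.
  case: p aQ {H H' sQ' aQ'} u l q a h => /= aQ u l q a h; last first.
    split => //; first by move=> x xy; apply: l; lia.
    by rewrite addn0 -[RHS]q addn1.
  have yin : y.+1 \in run true (rcons Q y.+1) y w.
    have : y.+1 \in rcons Q y.+1 by rewrite mem_rcons inE eqxx.
    by rewrite -{1}q mem_filter => /andP[].
  split => //.
  + move=> x xy; have [->//|ne] := eqVneq x y.+1; apply: l; lia.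
  + transitivity (filter (leq (y.+1 + 1)) (rcons Q y.+1)).
      rewrite -[in RHS]q -filter_predI; apply: eq_filter => x /=; lia.
    rewrite filter_rcons (_ : _ <= _ = false); last by lia.
    by apply/all_filterP.
  + by move=> _; have := h isT; lia.
move=> H /= cw sQ aQ; rewrite add0n in cw; case: p H aQ => H aQ.
- have H' : pathto (size Q + false) w 0.
    by move: H; rewrite addn1 addn0 pathto_D.
  have aQ' : all (leq (y + false)) Q by apply: sub_all aQ => x /=; lia.
  have [u l q a h] := IH _ _ _ H' cw sQ aQ'.
  have ynot : y \notin run false Q y w.
    apply/negP => yin; have : y \in Q by rewrite -q mem_filter addn0 leqnn.
    by move/(allP aQ) => /=; lia.
  split => //=.
  + by rewrite ynot.
  + move=> x xy; rewrite inE; have [//|ne] := eqVneq x y; apply: l; lia.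
  + rewrite (_ : _ <= _ = false); last by lia.
    rewrite -[RHS]q; apply: eq_in_filter => x xin /=.
    have : x != y by apply: contraNneq ynot => E; rewrite -{1}E.
    by rewrite addn0 addn1; lia.
  + rewrite a andbT; rewrite (_ : filter _ _ = Q) // -[RHS]q.
    apply: eq_in_filter => x xin /=.
    have : x != y by apply: contraNneq ynot => E; rewrite -{1}E.
    by rewrite addn0; lia.
- case: Q H sQ aQ => [|q0 Q] H sQ aQ /=.
    by move: H; rewrite /pathto.
  have H' : pathto (size Q + false) w 0.
    by move: H; rewrite /= !addn0 pathto_D.
  move: aQ => /= /andP[aq aQ].
  have sQ0 := path_sorted sQ.
  have gQ : all (gtn q0) Q by apply: order_path_min sQ; exact: gtn_trans.
  have [u l q a h] := IH _ _ _ H' cw sQ0 aQ.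
  have qnot x : q0 <= x -> x \notin run false Q y w.
    move=> qx; apply/negP => xin; have : x \in Q.
      by rewrite -q mem_filter xin andbT; lia.
    by move/(allP gQ) => /=; lia.
  split => //=.
  + by rewrite qnot.
  + by move=> x xy; rewrite inE l ?orbT.
  + by rewrite aq q.
  + rewrite a andbT (_ : filter _ _ = [::]) //.
    apply/eqP; rewrite -(negbK (_ == _)) -has_filter; apply/hasPn => x xin.
    by apply/negP => /= qx; move: xin; apply/negP/qnot; lia.
Qed.

(** The word is read off greedily. A next entry [v < y] is still unread and forces an up step;
    otherwise a down step outputs [v], which is [y] after an up step and the head of the queue in
    the other case. *)
Lemma fits_run (p : bool) Q y s :
  sorted gtn Q -> all (leq (y + p)) Q -> fits p Q y s ->
  exists w, [/\ pathto (size Q + p) w 0, cU w = y & run p Q y w = s].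
Proof.
have [N] := ubnP (size s + y).
elim: N p Q y s => // N IH p Q y [|v s] lN sQ aQ [u l q a h].
  exists [::]; move: q => /= q.
  have y0 : y + p = 0.
    by case E: (y + p) => // [m]; have := l 0; rewrite E in_nil => /(_ isT).
  by split=> //; first (rewrite /pathto -q /=); lia.
move: u a => /= /andP[vs us] /andP[av_v a].
have below : v < y -> exists w, [/\ pathto (size Q + p) w 0, cU w = y & run p Q y w = v :: s].
  case: y lN aQ l q h => // y lN aQ l q h vy.
  pose Q' := if p then rcons Q y.+1 else Q.
  have sQ' : sorted gtn Q'.
    rewrite /Q'; case: (p) aQ => // aQ; apply: queue_rcons => //.
    by apply: sub_all aQ => x /=; lia.
  have aQ' : all (leq (y + true)) Q'.
    rewrite /Q'; case: (p) aQ => aQ; rewrite ?all_rcons ?addn1 ?leqnn /=;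
      by apply: sub_all aQ => x /=; lia.
  have f' : fits true Q' y (v :: s).
    split => /=; rewrite ?vs ?av_v //; first by move=> x xy; apply: l; lia.
    rewrite /Q' addn1; case: (p) l q aQ => l q aQ; last by rewrite -q addn0 /=.
    (* Two decreasing lists with the same elements are equal. The entries above [v] decrease because
       [v] starts no 123 pattern, and those above [y] are among them. *)
    apply: (irr_sorted_eq gtn_trans (fun x => ltnn x)).
    - rewrite leqNgt vy /=.
      have -> : [seq x <- s | y < x] = [seq x <- [seq x <- s | v < x] | y < x].
        by rewrite -filter_predI; apply: eq_filter => x /=; lia.
      exact: sorted_filter gtn_trans _ _ av_v.
    - by apply: queue_rcons => //; apply: sub_all aQ => x /=; lia.
    - move=> x; rewrite mem_rcons inE -q.
      have -> : (if y < v then v :: [seq x <- s | y < x] else [seq x <- s | y < x])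
         = filter (ltn y) (v :: s) by [].
      rewrite !mem_filter /=.
      have [->|ne] := eqVneq x y.+1; last by rewrite addn1; congr (_ && _); lia.
      by rewrite ltnSn l //; lia.
  have lN' : size (v :: s) + y < N by move: lN => /=; lia.
  have [w [H cw E]] := IH true Q' y (v :: s) lN' sQ' aQ' f'.
  exists (true :: w); split; rewrite ?E //= ?cw //.
  by move: H; rewrite pathto_U /Q'; case: (p); rewrite ?size_rcons ?addn1 ?addn0.
have [|yv] := ltnP v y; first exact: below.
have us' : fits false (filter (leq y) s) y s.
  split => //; rewrite ?addn0 // => x xy; have := l x; rewrite inE => /(_ _) /orP[|/eqP e|//].
    by lia.
  by lia.
case: p l q h aQ below => l q h aQ below.
- have vy : v = y by have := h isT => /=; lia.
  subst v.
  have E : filter (leq y) s = Q.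
    rewrite -q /= addn1 ltnn; apply: eq_in_filter => x xin /=.
    have : x != y by apply: contraNneq vs => <-.
    by lia.
  rewrite E in us'.
  have lN' : size s + y < N by move: lN => /=; lia.
  have aQ' : all (leq (y + false)) Q by apply: sub_all aQ => x /=; lia.
  have [w [H cw Er]] := IH false Q y s lN' sQ aQ' us'.
  exists (false :: w); split; rewrite /= ?Er //.
  by move: H; rewrite addn1 addn0 pathto_D.
- move: q; rewrite /= addn0 yv => q.
  set Q' := filter (leq y) s in q us'.
  have lN' : size s + y < N by move: lN => /=; lia.
  move: sQ aQ; rewrite -q /= => sQ /andP[_ aQ].
  have [w [H cw Er]] := IH false Q' y s lN' (path_sorted sQ) aQ us'.
  by exists (false :: w); split; rewrite /= ?Er // addn0 pathto_D -[size _]addn0.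
Qed.

(** The first output reveals the first step: it is below [y] after an initial up step and at least
    [y] after an initial down step. This is [sep]. *)
Lemma run_inj (p : bool) Q y w1 w2 :
  pathto (size Q + p) w1 0 -> cU w1 = y ->
  pathto (size Q + p) w2 0 -> cU w2 = y ->
  sorted gtn Q -> all (leq (y + p)) Q ->
  run p Q y w1 = run p Q y w2 -> w1 = w2.
Proof.
have sep (p' : bool) Q' y' v1 v2 : pathto (size Q' + p') (true :: v1) 0 ->
  cU (true :: v1) = y' -> pathto (size Q' + p') (false :: v2) 0 ->
  sorted gtn Q' -> all (leq (y' + p')) Q' ->
  run p' Q' y' (true :: v1) <> run p' Q' y' (false :: v2).
  move=> H1 c1 H2 sQ aQ E.
  have [_ _ _ _ hd] : fits true (if p' then rcons Q' y' else Q') y'.-1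
      (run p' Q' y' (true :: v1)).
    apply: run_fits; rewrite -?c1 //=.
    - by move: H1; rewrite pathto_U; case: (p'); rewrite ?size_rcons ?addn1 ?addn0.
    - case: (p') aQ => // aQ; apply: queue_rcons => //.
      by apply: sub_all aQ => x /=; rewrite -c1 /=; lia.
    - case: (p') aQ => aQ; rewrite ?all_rcons ?addn1 ?leqnn /=;
        by apply: sub_all aQ => x /=; rewrite -c1 /=; lia.
  have := hd isT; rewrite E /= -c1 /=.
  case: (p') H2 aQ => /=; first by lia.
  case: (Q') => [|q Q0] //= _; rewrite -c1 /=; lia.
elim: w1 p Q y w2 => [|x1 w1 IH] p Q y [|x2 w2] //.
- move=> /andP[_ /eqP /= +] c1 H2 c2; rewrite !addn0 => H0.
  move: H2 c2; rewrite H0 -c1 /pathto /=.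
  by case: x2.
- move=> H1 c1 /andP[_ /eqP /= +] c2; rewrite !addn0 => H0.
  move: H1 c1; rewrite H0 -c2 /pathto /=.
  by case: x1.
case: x1; case: x2 => H1 c1 H2 c2 sQ aQ E.
- congr cons; apply: (IH true (if p then rcons Q y else Q) y.-1) => //=;
    rewrite -?c1 -?c2 //=.
  + by move: H1; rewrite pathto_U; case: (p); rewrite ?size_rcons ?addn1 ?addn0.
  + by move: H2; rewrite pathto_U; case: (p); rewrite ?size_rcons ?addn1 ?addn0.
  + by move: c1 c2 => /=; lia.
  + case: (p) aQ => // aQ; apply: queue_rcons => //.
    by apply: sub_all aQ => x /=; rewrite -c1 /=; lia.
  + case: (p) aQ => aQ; rewrite ?all_rcons ?addn1 ?leqnn /=;
      by apply: sub_all aQ => x /=; rewrite -c1 /=; lia.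
- by case: (sep _ _ _ _ _ H1 c1 H2 sQ aQ E).
- by case: (sep _ _ _ _ _ H2 c2 H1 sQ aQ (esym E)).
- congr cons; move: E => /=; case: p H1 H2 aQ => H1 H2 aQ [E].
  + apply: (IH false Q y) => //.
    * by move: H1; rewrite addn1 addn0 pathto_D.
    * by move: H2; rewrite addn1 addn0 pathto_D.
    * by apply: sub_all aQ => x /=; lia.
  + case: Q H1 H2 sQ aQ E => [|q Q] H1 H2 sQ /= aQ E //.
    apply: (IH false Q y) => //.
    * exact: path_sorted sQ.
    * by case/andP: aQ.
Qed.

(** * Fixed points *)

Fixpoint peaks (p : bool) (w : seq bool) : nat :=
  if w is x :: w' then (p && ~~ x) + peaks x w' else 0.

(* The values that [run p _ y w] appends to its queue. *)
Fixpoint queued (p : bool) (y : nat) (w : seq bool) : seq nat :=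
  match w with
  | [::] => [::]
  | true :: w' => (if p then [:: y] else [::]) ++ queued true y.-1 w'
  | false :: w' => queued false y w'
  end.

Lemma peaks_cat p u v : peaks p (u ++ v) = peaks p u + peaks (last p u) v.
Proof. by elim: u p => //= x u IH p; rewrite IH addnA. Qed.

Lemma peaks_rcons p w x : peaks p (rcons w x) = peaks p w + (last p w && ~~ x).
Proof. by rewrite -cats1 peaks_cat /= addn0. Qed.

Lemma peaks_revneg w : peaks false (revneg w) = peaks false w.
Proof.
elim: w => //= x w IH; rewrite revneg_cons peaks_rcons IH negbK.
rewrite addnC; case: x; last by rewrite andbF.
rewrite andbT; case: w {IH} => //= x w.
by rewrite revneg_cons last_rcons; case: x.
Qed.

Lemma peaks_bound p w : peaks p w <= cD w.
Proof. by elim: w p => //= x w IH p; have := IH x; case: x; case: p => /=; lia. Qed.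

Lemma queued_cat p y u v :
  queued p y (u ++ v) = queued p y u ++ queued (last p u) (y - cU u) v.
Proof.
elim: u p y => [|x u IH] p y /=; first by rewrite subn0.
by case: x => /=; rewrite IH ?catA; congr (_ ++ queued _ _ _); lia.
Qed.

(** Each up step, including the one recorded by [p], is followed by a down step (a peak) or by an up
    step (its value is queued), or it is the last step. *)
Lemma size_queued p y w :
  size (queued p y w) + peaks p w + last p w = cU w + p.
Proof.
elim: w p y => //= x w IH p y; case: x => /=.
  by rewrite size_cat; have := IH true y.-1; case: p => /=; lia.
by have := IH false y; case: p => /=; lia.
Qed.

Lemma queued_range p y w x : cU w <= y ->
  x \in queued p y w -> y - cU w < x < y + p.
Proof.
elim: w p y => //= b w IH p y; case: b => /=; last first.
  by move=> cy /(IH _ _ cy); case: p; lia.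
move=> cy; rewrite mem_cat => /orP[|/IH]; last by case: p; lia.
by case: p => //; rewrite inE => /eqP ->; lia.
Qed.

Lemma queued_sorted p y w : cU w <= y -> sorted gtn (queued p y w).
Proof.
elim: w p y => //= b w IH p y; case: b => /=; last exact: IH.
move=> cy; have s := IH true y.-1; case: p => /=; last by apply: s; lia.
rewrite (path_sortedE gtn_trans) s ?andbT; last by lia.
by apply/allP => x /queued_range /=; lia.
Qed.

(** A value is queued only when the next up step comes, so the split is made between the step that
    reads it and the step that queues it. *)
Lemma queued_split p y w j : j < size (queued p y w) ->
  exists u v, [/\ w = u ++ true :: v, last p u & size (queued p y u) = j].
Proof.
elim: w p y j => //= b w IH p y j; case: b => /=; last first.
  by move=> /IH[u [v [-> l s]]]; exists (false :: u), v.
rewrite size_cat; case: p => /= lj.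
  case: j lj => [_|j lj]; first by exists [::], w.
  have /IH[u [v [-> l s]]] : j < size (queued true y.-1 w) by lia.
  by exists (true :: u), v; split => //=; rewrite s.
have /IH[u [v [-> l s]]] := lj.
by exists (true :: u), v.
Qed.

(** Of the [cD u] earlier down steps, [peaks p u] end peaks and the others pop the queue; first in,
    first out gives the index. Listing also the values queued later gives one list for all
    positions. *)
Lemma run_nth (p : bool) Q y u v :
  nonneg (size Q + p) (u ++ false :: v) ->
  nth 0 (run p Q y (u ++ false :: v)) (cD u) =
  if last p u then y - cU u
  else nth 0 (Q ++ queued p y (u ++ false :: v)) (cD u - peaks p u).
Proof.
elim: u p Q y => [|x u IH] p Q y /=.
  by case: p => /=; [rewrite subn0 | case: Q].
case: x => /=.
  move=> H; rewrite andbF !add0n IH; last first.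
    by move: H; case: (p); rewrite ?size_rcons ?addn1 ?addn0.
  case: (last true u); first by lia.
  by case: (p); rewrite ?cat_rcons.
move=> /andP[h0 H]; rewrite andbT add1n; case: p h0 H => h0 H.
  rewrite /= IH; last by rewrite addn0; rewrite addn1 in H.
  by rewrite add0n subSS.
case: Q h0 H => // q Q _ H.
rewrite /= IH; last by move: H; rewrite /= !addn0.
rewrite !add0n; case: ifP => // _.
have := peaks_bound false u.
by move=> le; rewrite subSn.
Qed.

(** When the last step is not an up step, the length of the queue is the height of the path, which
    is positive before a down step. *)
Lemma queue_nonempty (p : bool) k y u v :
  nonneg (k + p) (u ++ false :: v) -> last p u = false ->
  cD u - peaks p u < k + size (queued p y u).
Proof.
rewrite nonneg_cat => /andP[/nonneg_bound le1 /= /andP[h0 _]] l.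
by have := size_queued p y u; have := peaks_bound p u; rewrite l; lia.
Qed.

Lemma split_nth_D w c : c < cD w ->
  exists u v, w = u ++ false :: v /\ cD u = c.
Proof.
elim: w c => //= x w IH c; case: x => /=.
  by move=> /IH[u [v [-> e]]]; exists (true :: u), v.
case: c => [_|c cw]; first by exists [::], w.
have /IH[u [v [-> e]]] : c < cD w by lia.
by exists (false :: u), v; rewrite /= e.
Qed.

Lemma split_prefix (u v u' v' : seq bool) :
  u ++ v = u' ++ v' -> size u <= size u' -> exists t, u' = u ++ t /\ v = t ++ v'.
Proof.
elim: u u' => [|x u IH] [|x' u'] //=; first by move=> ->; exists [::].
  by move=> -> _; exists (x' :: u').
by case=> -> /IH H /H[t [-> ->]]; exists t.
Qed.

(** * Two fixed points in terms of the two halves of the path *)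

Definition top_fixed (b : nat) (s : seq nat) : bool :=
  (nth 0 s b == b) && has (fun a => nth 0 s a == a) (iota 0 b).

(* The i-th up step of A is followed by another one, so it is not in a peak. *)
Definition halfpath (i : nat) (A u v : seq bool) : Prop :=
  [/\ A = u ++ [:: true, true & v], (cU u).+1 = i & last true v].

Lemma pathto_counts w n : pathto 0 w 0 -> size w = n + n -> cU w = n /\ cD w = n.
Proof. by move=> /andP[_ /eqP]; have := count_UD w; lia. Qed.

Lemma revneg_last v : last true v -> exists t, revneg (true :: v) = false :: t.
Proof.
case/lastP: v => [|v x]; first by exists [::].
by rewrite last_rcons => ->; rewrite -cats1 revneg_cons revneg_cat /=; eexists.
Qed.

Lemma revneg_last_false M : last false M = false ->
  exists2 v, revneg (false :: M) = true :: v & last true v.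
Proof.
case/lastP: M => [|M x]; first by exists [::].
rewrite last_rcons => ->; exists (rcons (revneg M) true); last by rewrite last_rcons.
by rewrite -[rcons M false]cats1 revneg_cons revneg_cat.
Qed.

(** Both halves end with an up step, so there is a peak after exactly [n] steps; its position [cD A]
    equals its value [n - cU A]. The peak count then makes the queue deliver the value [b], read in
    [A], at the position [b], read in [B]. *)
Lemma top_fixed_halves n b A B : size A = n -> size B = n -> b < n ->
  pathto 0 (A ++ revneg B) 0 -> forall u v u' v',
  halfpath (n - b) A u v -> halfpath (n - b) B u' v' ->
  peaks true v + peaks true v' + 2 * (n - b) = n ->
  top_fixed b (run false [::] n (A ++ revneg B)).
Proof.
move=> sA sB bn path u v u' v' [eA cu lv] [eB cu' lv'] pk.
have sw : size (A ++ revneg B) = n + n by rewrite size_cat size_revneg sA sB.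
have [cUw cDw] := pathto_counts path sw.
have nn : nonneg (size ([::] : seq nat) + false) (A ++ revneg B).
  by case/andP: path.
have cA := count_UD A; rewrite sA in cA.
have cUA : cU A = (n - b).+1 + cU v by rewrite eA count_cat /= -cu; lia.
have eBr : revneg B = rcons (revneg (true :: v')) false ++ revneg u'.
  by rewrite eB revneg_cat [revneg (_ :: _ :: _)]revneg_cons.
apply/andP; split; last first.
  apply/hasP; exists (cD A); first by rewrite mem_iota; lia.
  have [t et] : exists t, revneg B = false :: t.
    by have [t et] := revneg_last lv'; rewrite eBr et /=; eexists.
  move: nn; rewrite et => nn; rewrite (run_nth _ nn).
  have -> : last false A by rewrite eA last_cat /=.
  by apply/eqP; lia.
set M := revneg (true :: v') in eBr.
have cDM : cD M = (cU v').+1 by rewrite cD_revneg.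
have E : A ++ revneg B = (A ++ M) ++ false :: revneg u'.
  by rewrite eBr cat_rcons catA.
have cDAM : cD (A ++ M) = b.
  move: cDw; rewrite E [cD (_ ++ _ :: _)]count_cat /= cD_revneg; lia.
have lM : last false (A ++ M) = false.
  by rewrite last_cat /M revneg_cons last_rcons.
have := nn; rewrite E => nn'; have := run_nth n nn'.
rewrite cDAM lM => ->; rewrite cat0s.
have -> : (A ++ M) ++ false :: revneg u' = rcons u true ++ (true :: v ++ M ++ false :: revneg u').
  by rewrite eA -!catA /= cat_rcons.
rewrite queued_cat last_rcons /= nth_cat.
have pM : peaks true M = (peaks true v').+1.
  have := peaks_revneg (true :: v'); rewrite -/M.
  by have [t et] := revneg_last lv'; rewrite /M et /= !add0n add1n => ->.
have pAM : peaks false (A ++ M) = peaks false u + peaks true v + (peaks true v').+1.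
  rewrite peaks_cat eA peaks_cat last_cat /= lv pM andbF; lia.
have := size_queued false n (rcons u true); rewrite last_rcons peaks_rcons andbF.
rewrite -[in RHS]cats1 count_cat /= pAM => sz.
(* The left side counts the pops before position [b], the right side the values queued before the
   value [b]; [pk] says that they agree. *)
have -> : b - (peaks false u + peaks true v + (peaks true v').+1) = size (queued false n (rcons u true)) by lia.
by rewrite ltnn subnn /= -cats1 count_cat /=; apply/eqP; lia.
Qed.

(** The word is cut before the down steps of positions [a] and [b]. Of the four cases for the steps
    before the cuts, only one is possible: [a] at a peak and [b] popped from the queue. *)
Lemma halves_top_fixed n b w : size w = n + n -> b < n -> pathto 0 w 0 ->
  top_fixed b (run false [::] n w) ->
  exists A B u v u' v', [/\ w = A ++ revneg B, size A = n /\ size B = n,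
    halfpath (n - b) A u v, halfpath (n - b) B u' v' &
    peaks true v + peaks true v' + 2 * (n - b) = n].
Proof.
move=> sw bn path /andP[/eqP fb /hasP[a]]; rewrite mem_iota /= => ab /eqP fa.
have [cUw cDw] := pathto_counts path sw.
have nn : nonneg (size ([::] : seq nat) + false) w by case/andP: path.
have [Xb [Yb [eb cb]]] : exists u v, w = u ++ false :: v /\ cD u = b.
  by apply: split_nth_D; rewrite cDw.
have [Xa [Ya [ea ca]]] : exists u v, w = u ++ false :: v /\ cD u = a.
  by apply: split_nth_D; rewrite cDw; lia.
have [M [eXb eYa]] : exists M, Xb = Xa ++ false :: M /\ Ya = M ++ false :: Yb.
  have [le|lt] := leqP (size Xa) (size Xb); last first.
    have [t [et _]] := split_prefix (etrans (esym eb) ea) (ltnW lt).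
    by move: ca; rewrite et count_cat; lia.
  have [[|x t] [et e]] := split_prefix (etrans (esym ea) eb) le.
    by move: cb; rewrite et cats0; lia.
  by case: e et => <- e et; exists t.
have := nn; rewrite {1}ea => nna; have := nn; rewrite {1}eb => nnb.
have cUXb : cU Xb <= n by rewrite -cUw eb count_cat; lia.
have cUXa : cU Xa <= cU Xb by rewrite eXb count_cat; lia.
have qw : queued false n w = queued false n Xb ++ queued (last false Xb) (n - cU Xb) (false :: Yb).
  by rewrite eb queued_cat.
have qa : queued false n w = queued false n Xa ++ queued (last false Xa) (n - cU Xa) (false :: Ya).
  by rewrite ea queued_cat.
have := run_nth n nnb; rewrite -eb cb fb cat0s.
have := run_nth n nna; rewrite -ea ca fa cat0s.
(* A value popped from the queue was pushed earlier, hence exceeds the current minimum. *)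
have qlt : last false Xa = false -> n - cU Xa < nth 0 (queued false n w) (a - peaks false Xa).
  move=> la; have := queue_nonempty n nna la; rewrite ca add0n => lt.
  rewrite qa nth_cat lt.
  by have := queued_range (leq_trans cUXa cUXb) (mem_nth 0 lt); case/andP.
have sa := size_queued false n Xa; have sb := size_queued false n Xb.
have pa := peaks_bound false Xa; have pb := peaks_bound false Xb.
case la: (last false Xa) sa => sa ha; case lb: (last false Xb) sb => sb hb.
(* Two peaks: each cut would come after exactly [n] steps, but [Xb] is longer than [Xa]. *)
- by have := count_UD Xa; have := count_UD Xb; rewrite eXb !count_cat /= in hb cb cUXa *; lia.
(* The possible case: the last step of [u0] reads the value [b], and the cut at [a] is the middle of
   the word. *)
- have ltb := queue_nonempty n nnb lb; rewrite cb add0n in ltb.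
  have ltw : b - peaks false Xb < size (queued false n w) by rewrite qw size_cat; lia.
  have [u0 [v0 [eu lu su]]] := queued_split ltw.
  move: hb; rewrite {1}eu queued_cat lu nth_cat su ltnn subnn /= => hb.
  have cu0 : cU u0 <= n by rewrite -cUw eu count_cat; lia.
  have [t [eXa ev]] : exists t, Xa = u0 ++ t /\ true :: v0 = t ++ false :: Ya.
    apply: split_prefix; first by rewrite -eu.
    (* If [u0] reached beyond [Xa], then [n - cU u0 <= n - cU Xa], that is, [b <= a]. *)
    rewrite leqNgt; apply/negP => lt.
    have [t [et _]] := split_prefix (etrans (esym ea) eu) (ltnW lt).
    by move: hb; rewrite et count_cat; lia.
  case: t eXa ev => [|x t] eXa // [ex ev]; rewrite -{x}ex in eXa.
  case/lastP: u0 => [|u x] // in eu lu su hb cu0 eXa *.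
  rewrite last_rcons in lu; rewrite {x}lu in eu su hb cu0 eXa.
  have lM : last false M = false by move: lb; rewrite eXb last_cat.
  have [v' ev' lv'] := revneg_last_false lM.
  have sXa : size Xa = n by have := count_UD Xa; lia.
  exists Xa, (revneg (false :: Ya)), u, t, (revneg Yb), v'; split.
  + by rewrite revnegK.
  + split=> //; rewrite size_revneg; move: sw; rewrite ea size_cat; lia.
  + split; first by rewrite eXa cat_rcons.
      by move: hb; rewrite -cats1 count_cat /=; lia.
    by move: la; rewrite eXa last_cat /=.
  + split=> //; first by rewrite eYa -cat_cons revneg_cat ev' revneg_cons cat_rcons.
    by move: cDw; rewrite cU_revneg eb count_cat cb /=; lia.
  + have := size_queued false n (rcons u true); rewrite su last_rcons.
    have := peaks_revneg (false :: M); rewrite ev' /= add0n.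
    rewrite cb in pb; move: pb hb; rewrite eXb eXa !peaks_cat !last_cat !last_rcons /= => pb.
    rewrite -[in cU _]cats1 count_cat /=.
    have lt : last true t = true by move: la; rewrite eXa last_cat.
    by rewrite lt /= in pb *; lia.
- by have := qlt la; lia.
(* Two pops: the queue is decreasing and position [b] pops later, so [b < a]. *)
- have ltb := queue_nonempty n nnb lb; rewrite cb add0n in ltb.
  have := queued_sorted false (_ : cU w <= n); rewrite cUw => /(_ (leqnn _)).
  rewrite (sorted_pairwise gtn_trans) => /(pairwiseP 0) S.
  have := S (a - peaks false Xa) (b - peaks false Xb); rewrite !inE -hb -ha /= => lt.
  have ltw : b - peaks false Xb < size (queued false n w) by rewrite qw size_cat; lia.
  have pX : peaks false Xb = peaks false Xa + peaks false M by rewrite eXb peaks_cat la.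
  have cX : a + (1 + cD M) = b by rewrite -cb eXb count_cat ca.
  have pM := peaks_bound false M; rewrite ca in pa.
  have ltab : a - peaks false Xa < b - peaks false Xb by lia.
  by have := lt (ltn_trans ltab ltw) ltw ltab; lia.
Qed.

(** * Permutations *)

Lemma sorted_above x s : uniq s ->
  sorted gtn (filter (ltn x) s) = pairwise (fun a b => ~~ ((x < a) && (a < b))) s.
Proof.
elim: s => //= a s IH /andP[ans us]; rewrite -(IH us).
case: (ltnP x a) => xa /=; last first.
  by rewrite (_ : all _ _) //; apply/allP.
rewrite (path_sortedE gtn_trans); congr (_ && _).
apply/allP/allP => H b.
  move=> bs; rewrite -leqNgt; case: (leqP b x) => [bx|xb]; first by lia.
  by apply/ltnW/H; rewrite mem_filter /= xb.
rewrite mem_filter => /andP[/= xb bs].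
have := H b bs; have : a != b by apply: contraNneq ans => ->.
by rewrite -leqNgt /=; lia.
Qed.

Lemma av123P s : uniq s ->
  reflect (forall i j k, i < j -> j < k -> k < size s ->
             ~~ ((nth 0 s i < nth 0 s j) && (nth 0 s j < nth 0 s k)))
          (av123 s).
Proof.
elim: s => [|x s IH] us; first by constructor.
rewrite [av123 _]/= sorted_above; last by case/andP: us.
move: us => /= /andP[_ us]; apply: (iffP andP) => [[/(pairwiseP 0) H0 /(IH us) H]|H].
  move=> [|i] [|j] [|k] // ij jk kl; last exact: H.
  by apply: H0; rewrite ?inE /=; lia.
split; last by apply/(IH us) => i j k ij jk kl; apply: (H i.+1 j.+1 k.+1).
apply/(pairwiseP 0) => j k _ kl jk.
exact: (H 0 j.+1 k.+1).
Qed.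

Definition oneline (n : nat) (pi : 'S_n) : seq nat := [seq val (pi i) | i <- enum 'I_n].

Lemma size_oneline n (pi : 'S_n) : size (oneline pi) = n.
Proof. by rewrite size_map size_enum_ord. Qed.

Lemma nth_oneline n (pi : 'S_n) (i : 'I_n) : nth 0 (oneline pi) i = pi i.
Proof. by rewrite (nth_map i) ?nth_ord_enum // size_enum_ord. Qed.

Lemma oneline_uniq n (pi : 'S_n) : uniq (oneline pi).
Proof. by rewrite map_inj_uniq ?enum_uniq // => i j /val_inj /perm_inj. Qed.

Lemma oneline_inj n : injective (@oneline n).
Proof.
move=> pi pj E; apply/permP => i; apply: val_inj.
by rewrite /= -!nth_oneline E.
Qed.

Lemma mem_oneline n (pi : 'S_n) x : (x \in oneline pi) = (x < n).
Proof.
apply/mapP/idP => [[i _ ->]|xn]; first exact: ltn_ord.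
by exists ((pi^-1)%g (Ordinal xn)); rewrite ?mem_enum // permKV.
Qed.

Lemma avoids123E n (pi : 'S_n) : avoids pattern123 pi = av123 (oneline pi).
Proof.
rewrite /avoids; apply/negP/(av123P (oneline_uniq pi)) => H.
- move=> i j k ij jk; rewrite size_oneline => kn; apply/negP => /andP[lij ljk].
  apply: H; have jn := ltn_trans jk kn; have lin := ltn_trans ij jn.
  pose t := [:: Ordinal lin; Ordinal jn; Ordinal kn].
  pose e := [ffun a : 'I_3 => nth (Ordinal kn) t a].
  move: lij ljk; rewrite -[i]/(val (Ordinal lin)) -[j]/(val (Ordinal jn)) -[k]/(val (Ordinal kn)).
  rewrite !nth_oneline => lij ljk.
  apply/existsP; exists e; apply/andP; split; apply/forallP => a; apply/forallP => b.
    by rewrite !ffunE; case: a b => -[|[|[|a]]] ? [[|[|[|b]]] ?] //=; lia.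
  rewrite !ffunE !perm1; case: a b => -[|[|[|a]]] ? [[|[|[|b]]] ?] //=; lia.
- case/existsP => e /andP[/forallP e1 /forallP e2].
  have E1 (a b : 'I_3) : a < b -> e a < e b by move: (e1 a) => /forallP/(_ b)/implyP.
  have E2 (a b : 'I_3) : a < b -> pi (e a) < pi (e b).
    by move: (e2 a) => /forallP/(_ b)/eqP; rewrite !perm1 => ->.
  pose o0 : 'I_3 := @Ordinal 3 0 isT; pose o1 : 'I_3 := @Ordinal 3 1 isT.
  pose o2 : 'I_3 := @Ordinal 3 2 isT.
  have := H (e o0) (e o1) (e o2) (E1 o0 o1 isT) (E1 o1 o2 isT).
  by rewrite size_oneline !nth_oneline !E2 // => /(_ (ltn_ord _)).
Qed.

Lemma fits_oneline n (pi : 'S_n) : avoids pattern123 pi -> fits false [::] n (oneline pi).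
Proof.
rewrite avoids123E => a; split => //; first exact: oneline_uniq.
  by move=> x; rewrite addn0 mem_oneline.
apply/eqP; rewrite -[_ == _]negbK -has_filter; apply/hasPn => x.
by rewrite mem_oneline /= addn0 -ltnNge.
Qed.

Lemma oneline_fits n s : fits false [::] n s -> exists2 pi : 'S_n, avoids pattern123 pi & oneline pi = s.
Proof.
case; rewrite addn0 => us low q a _.
have mem_s x : (x \in s) = (x < n).
  apply/idP/idP => [xs|]; last exact: low.
  rewrite ltnNge; apply/negP => nx.
  have : x \in ([::] : seq nat) by rewrite -q mem_filter nx.
  by [].
have ss : size s = n.
  have : perm_eq s (iota 0 n) by apply: uniq_perm; rewrite ?iota_uniq // => x; rewrite mem_s mem_iota.
  by move/perm_size; rewrite size_iota.
have lt_nth (i : 'I_n) : nth 0 s i < n by rewrite -mem_s mem_nth ?ss.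
have inj : injective (fun i => Ordinal (lt_nth i)).
  by move=> i j [/eqP]; rewrite nth_uniq ?ss // => /eqP/val_inj.
have E : oneline (perm inj) = s.
  apply: (@eq_from_nth _ 0); rewrite size_oneline ?ss // => i lin.
  by rewrite -[i]/(val (Ordinal lin)) nth_oneline permE.
by exists (perm inj); rewrite ?avoids123E E.
Qed.

Lemma sum_pred_count (T : Type) (s : seq T) (P : pred T) : \sum_(x <- s) (P x : nat) = count P s.
Proof. by elim: s => [|x s IH]; rewrite ?big_nil // big_cons IH. Qed.

(** [run] is a bijection from Dyck words of length [n + n] onto the one-line forms of 123-avoiding
    permutations. *)
Lemma card_avoiding n (F : pred (seq nat)) :
  #|[set pi : 'S_n | avoids pattern123 pi & F (oneline pi)]| =
  \sum_(w <- words (n + n)) (pathto 0 w 0 && F (run false [::] n w) : nat).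
Proof.
rewrite sum_pred_count -size_filter cardE -(size_map (@oneline n)).
rewrite -(size_map (run false [::] n) (filter _ _)).
apply: perm_size; apply: uniq_perm.
- by rewrite (map_inj_uniq (@oneline_inj n)) enum_uniq.
- rewrite map_inj_in_uniq ?filter_uniq ?words_uniq // => w w'.
  rewrite !mem_filter !mem_words => /andP[/andP[p _] /eqP sw] /andP[/andP[p' _] /eqP sw'].
  have [c _] := pathto_counts p sw; have [c' _] := pathto_counts p' sw'.
  by apply: run_inj.
move=> s; apply/mapP/mapP => -[].
- move=> pi; rewrite mem_enum inE => /andP[a Fpi] ->.
  have [w [p c E]] := fits_run (isT : sorted gtn [::]) isT (fits_oneline a).
  exists w => //; rewrite mem_filter E Fpi p /= mem_words -count_UD c.
  by apply/eqP; case/andP: p => _ /eqP /=; lia.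
- move=> w; rewrite mem_filter mem_words => /andP[/andP[p Fw] /eqP sw] ->.
  have [c _] := pathto_counts p sw.
  have [pi a E] := oneline_fits (run_fits (p := false) (Q := [::]) p c isT isT).
  by exists pi; rewrite ?E // mem_enum inE a E.
Qed.

(** Three fixed points form a 123 pattern, so at most one [b] is a fixed point with another one
    below it, and such a [b] exists exactly when there are two fixed points. *)
Lemma s2_123_top n :
  s2_123 n = \sum_(0 <= b < n) #|[set pi : 'S_n | avoids pattern123 pi & top_fixed b (oneline pi)]|.
Proof.
have cardE (P : pred 'S_n) : #|[set pi | P pi]| = \sum_(pi : 'S_n) (P pi : nat).
  by rewrite -sum1_card big_mkcond /=; apply: eq_bigr => pi _; rewrite inE; case: (P pi).
rewrite /s2_123 cardE.
under [RHS]eq_bigr => b _ do rewrite cardE.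
rewrite exchange_big; apply: eq_bigr => pi _ /=.
have [|//] := boolP (avoids pattern123 pi); last by rewrite big1.
rewrite avoids123E => /(av123P (oneline_uniq pi)); rewrite size_oneline => av /=.
rewrite big_mkord.
have topE (b : 'I_n) : top_fixed b (oneline pi) = (pi b == b) && [exists a : 'I_n, (a < b) && (pi a == a)].
  rewrite /top_fixed nth_oneline; congr (_ && _).
  apply/hasP/existsP => [[a]|[a /andP[ab /eqP fa]]].
    rewrite mem_iota /= add0n => ab; have an := ltn_trans ab (ltn_ord b).
    by rewrite -[a]/(val (Ordinal an)) nth_oneline => fa; exists (Ordinal an); rewrite ab.
  by exists (val a); rewrite ?mem_iota // nth_oneline fa.
have no3 (a b c : 'I_n) : a < b -> b < c -> pi a = a -> pi b = b -> pi c = c -> False.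
  move=> ab bc fa fb fc; have := av _ _ _ ab bc (ltn_ord c).
  by rewrite !nth_oneline fa fb fc ab bc.
have [/existsP[b]|] := boolP [exists b : 'I_n, top_fixed b (oneline pi)].
- rewrite topE => /andP[/eqP fb /existsP[a /andP[ab /eqP fa]]].
  have only c : pi c = c -> c = a \/ c = b.
    move=> fc; case: (ltngtP c a) => [ca|ac|/val_inj]; [|  |by left].
      by case: (no3 c a b).
    case: (ltngtP c b) => [cb|bc|/val_inj]; [|  |by right].
      by case: (no3 a c b).
    by case: (no3 a b c).
  rewrite (bigD1 b) //= topE fb eqxx /= (_ : [exists _, _]); last first.
    by apply/existsP; exists a; rewrite ab fa eqxx.
  rewrite big1 ?addn0 => [|c cb]; last first.
    rewrite topE; apply/eqP; rewrite eqb0; apply/negP => /andP[/eqP /only[]].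
      move=> -> /existsP[d /andP[da /eqP /only[]]] e; subst d; lia.
    by move=> e; rewrite e eqxx in cb.
  rewrite /fp (_ : [set _ | _] = [set a; b]) ?cards2.
    by rewrite (_ : a != b) //; apply/eqP => e; subst; lia.
  apply/setP => c; rewrite !inE; apply/eqP/orP => [/only[]->|[]/eqP->] //; rewrite eqxx; by [left|right].
- move=> /existsPn H; rewrite big1 => [|c _]; last by rewrite (negbTE (H c)).
  apply/eqP; rewrite eqb0 /fp; apply/negP => /cards2P[x [y [xy S]]].
  have fx : pi x = x by apply/eqP; have := set21 x y; rewrite -S inE.
  have fy : pi y = y by apply/eqP; have := set22 x y; rewrite -S inE.
  case: (ltngtP x y) => [lt|lt|/val_inj e]; last by rewrite e eqxx in xy.
    have := H y; rewrite topE fy eqxx /= => /existsPn /(_ x).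
    by rewrite lt fx eqxx.
  have := H x; rewrite topE fx eqxx /= => /existsPn /(_ y).
  by rewrite lt fy eqxx.
Qed.

(** * Counting words *)

Definition ballot (h u m : nat) : nat :=
  \sum_(w <- words m) (nonneg h w && (cU w == u) : nat).

Lemma ballotS h u m : ballot h u m.+1 =
  (if u is u'.+1 then ballot h.+1 u' m else 0) +
  (if h is h'.+1 then ballot h' u m else 0).
Proof.
rewrite /ballot /= big_cat !big_map /=; congr (_ + _).
  by case: u => // ; rewrite big1 // => w _; rewrite add1n andbF.
by case: h => [|h] //=; rewrite big1.
Qed.

(** The reflection formula in additive form, proved by Pascal's rule on the first step. *)
Lemma ballotE h u d : d <= u + h + 1 ->
  ballot h u (u + d) + 'C(u + d, u + h + 1) = 'C(u + d, u).
Proof.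
have [m] := ubnP (u + d); elim: m h u d => // m IH h u d lm le.
case: u lm le => [|u] lm le.
  case: d lm le => [|d] lm le.
    by rewrite /ballot big_seq1 /= bin0 bin_small // addn1.
  rewrite add0n ballotS add0n bin0; case: h le => [|h] le.
    by have -> : d = 0 by lia.
  have E := IH h 0 d ltac:(lia) ltac:(lia); rewrite !add0n !addn1 bin0 in E.
  by rewrite !add0n !addn1 binS bin_small //; lia.
case: d lm le => [|d] lm le.
  rewrite addn0 ballotS binn bin_small; last by lia.
  have := IH h.+1 u 0 ltac:(lia) ltac:(lia); rewrite addn0 binn bin_small; last by lia.
  rewrite addn0 => ->; case: h {le} => // h; rewrite /ballot big_seq big1 // => w.
  rewrite mem_words => /eqP sw; have := count_UD w; rewrite sw.
  by case: eqP => [->|_ _]; rewrite ?andbF //; lia.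
rewrite addSn addnS ballotS.
have E1 := IH h.+1 u d.+1 ltac:(lia) ltac:(lia).
rewrite addnS in E1.
rewrite !addn1 !addSn [in 'C(_, (u + h).+2)]binS [in RHS]binS.
rewrite !addn1 !addnS in E1.
case: h E1 le => [|h] E1 le.
  by rewrite !addn0 in E1 *; lia.
have E2 := IH h u.+1 d ltac:(lia) ltac:(lia).
rewrite !addn1 !addSn in E2; rewrite !addnS in E1 E2 *; lia.
Qed.

(* Equals [binz (m - 1) k], in particular 0 when m = 0. *)
Definition binp (m k : nat) : nat := if m is m'.+1 then 'C(m', k) else 0.

Lemma binpS m k : binp m.+1 k.+1 = binp m k.+1 + binp m k.
Proof. by case: m => //= m; rewrite binS. Qed.

(** Final parts of half-paths: [b] is the step before, and [last b v] makes the half-path end with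
    an up step even when [v] is empty. *)
Definition tails (b : bool) (r u k m : nat) : nat :=
  \sum_(v <- words m) ([&& nonneg r v, peaks b v == k, last b v & cU v == u] : nat).

Lemma tailsS b r u k m : tails b r u k m.+1 =
  (if u is u'.+1 then tails true r.+1 u' k m else 0) +
  (if (0 < r) && (b <= k) then tails false r.-1 u (k - b) m else 0).
Proof.
rewrite /tails /= big_cat !big_map /=; congr (_ + _).
  case: u => [|u]; first by rewrite big1 // => w _; rewrite add1n /= !andbF.
  by apply: eq_bigr => w _; rewrite andbF.
case: ifP => [/andP[r0 bk]|H].
  apply: eq_bigr => w _; rewrite r0 andbT add0n.
  by congr (nat_of_bool [&& _, _, _ & _]); case: b bk => /=; lia.
rewrite big1 // => w _; case: (0 < r) H => //=; rewrite andbT => H.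
by rewrite (_ : _ == _ = false) ?andbF //; lia.
Qed.

Lemma tails0 b r u k : tails b r u k 0 = [&& k == 0, b & u == 0].
Proof. by rewrite /tails big_seq1 /=; congr nat_of_bool; case: k; case: u. Qed.

(** * Half-paths cut at the marked up step *)

Definition tailb (r k e : nat) (Z : seq bool) : bool :=
  if Z is true :: true :: v then
    [&& nonneg r.+1 v, peaks true v == k, last true v & (cU v).+2 == e]
  else false.

(** A decidable [halfpath] with statistics: [r] is the height after the i-th up step, [k] the number
    of peaks after it, [e] the total number of up steps. Before that step there are [i - 1] up and
    [i - r] down steps, hence the cut at [2 * i - r.+1]. *)
Definition halfb (i r k e : nat) (A : seq bool) : bool :=
  let m := 2 * i - r.+1 in
  (nonneg 0 (take m A) && (cU (take m A) == i.-1)) && tailb r k (e - i.-1) (drop m A).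

Lemma sum_tailb r k e l : 2 <= e ->
  \sum_(Z <- words l.+2) (tailb r k e Z : nat) = tails true r.+1 (e - 2) k l.
Proof.
case: e => [|[|e]] // _; rewrite /= !(big_cat, big_map) /=.
by rewrite [X in _ + X + _]big1 // [X in _ + (X + _)]big1 // [X in _ + (_ + X)]big1 // !addn0 subn2.
Qed.

(** The initial and final parts vary independently; the two fixed up steps between them lead from
    height [r - 1] to [r + 1]. *)
Lemma sum_halfb n i r k e : 1 <= r <= i -> 2 * i <= n -> i < e ->
  \sum_(A <- words n) (halfb i r k e A : nat) =
  ballot 0 i.-1 (2 * i - r.+1) * tails true r.+1 (e - i.+1) k (n - 2 * i + r.-1).
Proof.
move=> /andP[r1 ri] in2 ie; pose m := 2 * i - r.+1.
set l := n - 2 * i + r.-1; have -> : n = m + l.+2 by rewrite /m /l; lia.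
have -> : e - i.+1 = e - i.-1 - 2 by lia.
rewrite sum_words_cat -sum_tailb; last by lia.
rewrite big_distrl big_seq [RHS]big_seq; apply: eq_bigr => A1.
rewrite mem_words => /eqP sA1; rewrite big_distrr; apply: eq_bigr => Z _.
by rewrite /= mulnb /halfb -/m -sA1 take_size_cat // drop_size_cat.
Qed.

Lemma halfbP i r k e A : 1 <= r <= i -> i < e ->
  reflect (exists u v, [/\ halfpath i A u v, size u + r.+1 = 2 * i, nonneg 0 A,
                           peaks true v = k & cU A = e])
          (halfb i r k e A).
Proof.
move=> /andP[r1 ri] ie; rewrite /halfb; set m := 2 * i - r.+1.
apply: (iffP idP).
- move=> /andP[/andP[nu /eqP cu]].
  case E: (drop m A) => [|[] [|[] v]] //= /and4P[nv /eqP pv lv /eqP cv].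
  have su : size (take m A) = m.
    by rewrite size_take; case: ltnP => // le; move: E; rewrite drop_oversize.
  have eA : A = take m A ++ [:: true, true & v] by rewrite -E cat_take_drop.
  exists (take m A), v; split=> //.
  + by split=> //; lia.
  + by rewrite su /m; lia.
  + rewrite eA nonneg_cat nu /=.
    have cc := count_UD (take m A); rewrite su cu in cc.
    have -> : (0 + cU (take m A) - cD (take m A)).+2 = r.+1 by rewrite cu; lia.
    by [].
  + by rewrite eA count_cat /= cu; lia.
- case=> u [v [[eA cu lv] su nA pv cA]].
  have sm : m = size u by rewrite /m; lia.
  rewrite eA sm take_size_cat // drop_size_cat //= lv pv eqxx.
  move: nA cA; rewrite eA nonneg_cat count_cat /= => /andP[-> nv] cA.
  have cc := count_UD u.
  rewrite (_ : r.+1 = (0 + cU u - cD u).+2); last by lia.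
  by rewrite nv /=; lia.
Qed.

Lemma halfpath_unique i A u v u' v' : halfpath i A u v -> halfpath i A u' v' -> u = u' /\ v = v'.
Proof.
wlog le : u v u' v' / size u <= size u' => [W H H'|].
  have [le|lt] := leqP (size u) (size u'); first exact: W le H H'.
  by have [-> ->] := W _ _ _ _ (ltnW lt) H' H.
move=> [eA cu _] [eA' cu' _].
have [[|x t] [et e]] := split_prefix (etrans (esym eA) eA') le.
  by move: e et; rewrite cats0 => -[-> ] ->.
case: e et => <- _ et.
by move: cu'; rewrite et count_cat /=; lia.
Qed.

Lemma sum_nat_only (a b i0 : nat) (P : pred nat) (F : nat -> nat) :
  a <= i0 < b -> P i0 -> (forall i, a <= i < b -> P i -> i != i0 -> F i = 0) ->
  \sum_(a <= i < b | P i) F i = F i0.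
Proof.
move=> ab Pi0 F0; rewrite big_mkcond (bigD1_seq i0) ?iota_uniq ?mem_index_iota //=.
rewrite Pi0 big_seq_cond big1 ?addn0 // => i; rewrite mem_index_iota => /andP[iab ne].
by case: ifP => // Pi; apply: F0.
Qed.

Lemma halfpath_height i A u v : halfpath i A u v -> nonneg 0 A -> cD A < cU A.
Proof.
move=> [eA _ lv]; have : last false A by rewrite eA last_cat.
case/lastP: A {eA} => // w x; rewrite last_rcons => ->.
rewrite -cats1 nonneg_cat => /andP[/nonneg_bound le _].
by rewrite !count_cat /=; lia.
Qed.

(** This turns the indicator into a sum that factors over [A] and [B]. If the indicator is 1,
    exactly one tuple contributes: the heights after the marked up steps, the common final height
    [h], and the number [k] of peaks in the final part of [A]. Otherwise none does. *)
Lemma halves_sum n b A B : size A = n -> size B = n -> b < n ->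
  (pathto 0 (A ++ revneg B) 0 && top_fixed b (run false [::] n (A ++ revneg B)) : nat) =
  \sum_(1 <= r < (n - b).+1) \sum_(1 <= s < (n - b).+1)
    \sum_(1 <= h < n.+1 | ~~ odd (n - h)) \sum_(0 <= k < n.+1 - 2 * (n - b))
      halfb (n - b) r k (n + h)./2 A *
      halfb (n - b) s (n - 2 * (n - b) - k) (n + h)./2 B.
Proof.
move=> sA sB bn; set i := n - b.
have ehalf h : h <= n -> ~~ odd (n - h) -> 2 * (n + h)./2 = n + h.
  by move=> hn o; rewrite mul2n even_halfK // oddD; move: o; rewrite oddB // addbC.
have extract r s h k : 1 <= r < i.+1 -> 1 <= s < i.+1 -> 1 <= h < n.+1 -> ~~ odd (n - h) ->
    0 <= k < n.+1 - 2 * i ->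
    halfb i r k (n + h)./2 A * halfb i s (n - 2 * i - k) (n + h)./2 B != 0 ->
    exists u v u' v', [/\ halfpath i A u v /\ halfpath i B u' v',
      size u + r.+1 = 2 * i /\ size u' + s.+1 = 2 * i, nonneg 0 A /\ nonneg 0 B,
      peaks true v = k /\ peaks true v' = n - 2 * i - k &
      2 * cU A = n + h /\ 2 * cU B = n + h].
  move=> rr sr hr o kr; rewrite mulnb eqb0 negbK => /andP[].
  have E : 2 * (n + h)./2 = n + h by apply: ehalf => //; lia.
  have ie : i < (n + h)./2 by lia.
  move=> /(halfbP _ _ rr ie)[u [v [HA su nA pv cA]]].
  move=> /(halfbP _ _ sr ie)[u' [v' [HB su' nB pv' cB]]].
  by exists u, v, u', v'; rewrite cA cB.
case: (boolP (_ && _)) => [/andP[path /halves_top_fixed top]|none]; last first.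
  rewrite big_nat_cond big1 // => r /andP[rr _]; rewrite big_nat_cond big1 // => s /andP[sr _].
  rewrite big_nat_cond big1 // => h /andP[hr o].
  rewrite big_nat_cond big1 // => k /andP[kr _]; apply/eqP.
  apply: contraNT none => /(extract _ _ _ _ rr sr hr o kr).
  move=> [u [v [u' [v' [[HA HB] [su su'] [nA nB] [pv pv'] [cA cB]]]]]].
  have path : pathto 0 (A ++ revneg B) 0.
    rewrite pathto_cat_revneg nA nB /=.
    by have := count_UD A; have := count_UD B; rewrite sA sB; lia.
  rewrite path; apply: (top_fixed_halves sA sB bn path HA HB).
  by rewrite pv pv'; lia.
have sw : size (A ++ revneg B) = n + n by rewrite size_cat size_revneg sA sB.
have [A' [B' [u [v [u' [v' [eAB [sA' sB'] HA HB pk]]]]]]] := top sw bn path.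
have [eA eB] : A = A' /\ B = B'.
  move/eqP: eAB; rewrite eqseq_cat ?sA' // => /andP[/eqP -> /eqP E].
  by split=> //; apply: (inv_inj revnegK).
subst A' B'; rewrite -/i in HA HB pk.
move: path; rewrite pathto_cat_revneg => /and3P[nA nB /eqP hAB].
have hA := halfpath_height HA nA; have hB := halfpath_height HB nB.
(* The initial part has [i - 1] up steps and at most as many down steps, which puts [r0] and [s0]
   between 1 and [i]. *)
have range w x y : halfpath i w x y -> nonneg 0 w -> i.-1 <= size x <= 2 * i.-1.
  move=> [ew cx _]; rewrite ew nonneg_cat => /andP[/nonneg_bound le _].
  by have := count_UD x; lia.
have rA := range _ _ _ HA nA; have rB := range _ _ _ HB nB.
have i0 : 0 < i by rewrite /i; lia.
have cAn := count_UD A; have cBn := count_UD B; rewrite sA in cAn; rewrite sB in cBn.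
pose r0 := 2 * i - (size u).+1; pose s0 := 2 * i - (size u').+1.
pose h0 := 2 * cU A - n; pose k0 := peaks true v.
have rr0 : 1 <= r0 < i.+1 by rewrite /r0; lia.
have sr0 : 1 <= s0 < i.+1 by rewrite /s0; lia.
have hr0 : 1 <= h0 < n.+1 by rewrite /h0; lia.
have kr0 : 0 <= k0 < n.+1 - 2 * i by rewrite /k0; lia.
have o0 : ~~ odd (n - h0).
  by rewrite (_ : n - h0 = 2 * (n - cU A)) ?oddM // /h0; lia.
have uniq r s h k : 1 <= r < i.+1 -> 1 <= s < i.+1 -> 1 <= h < n.+1 -> ~~ odd (n - h) ->
    0 <= k < n.+1 - 2 * i ->
    ~~ [&& r == r0, s == s0, h == h0 & k == k0] ->
    halfb i r k (n + h)./2 A * halfb i s (n - 2 * i - k) (n + h)./2 B = 0.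
  move=> rr sr hr o kr ne; apply/eqP; apply: contraNT ne => /(extract _ _ _ _ rr sr hr o kr).
  move=> [x [y [x' [y' [[HA' HB'] [sx sx'] _ [py _] [cA _]]]]]].
  have [e1 e2] := halfpath_unique HA HA'; have [e3 e4] := halfpath_unique HB HB'.
  by rewrite /r0 /s0 /h0 /k0 e1 e2 e3; lia.
rewrite (sum_nat_only (i0 := r0)) //; last first.
  move=> r rr _ ne; rewrite big_nat_cond big1 // => s /andP[sr _].
  rewrite big_nat_cond big1 // => h /andP[hr o].
  by rewrite big_nat_cond big1 // => k /andP[kr _]; apply: uniq => //; rewrite (negbTE ne).
rewrite (sum_nat_only (i0 := s0)) //; last first.
  move=> s sr _ ne; rewrite big_nat_cond big1 // => h /andP[hr o].
  by rewrite big_nat_cond big1 // => k /andP[kr _]; apply: uniq => //; rewrite (negbTE ne) andbF.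
rewrite (sum_nat_only (i0 := h0)) //; last first.
  move=> h hr o ne.
  by rewrite big_nat_cond big1 // => k /andP[kr _]; apply: uniq => //; rewrite (negbTE ne) !andbF.
rewrite (sum_nat_only (i0 := k0)) //; last first.
  by move=> k kr _ ne; apply: uniq => //; rewrite (negbTE ne) !andbF.
have E : (n + h0)./2 = cU A by have := ehalf h0; rewrite /h0 => /(_ _ o0); lia.
have iA : i < cU A by lia.
have wA : halfb i r0 k0 (cU A) A.
  by apply/(halfbP _ _ rr0 iA); exists u, v; split=> //; rewrite /r0; lia.
have wB : halfb i s0 (n - 2 * i - k0) (cU A) B.
  by apply/(halfbP _ _ sr0 iA); exists u', v'; split=> //; rewrite /s0 /k0; lia.
by rewrite E wA wB.
Qed.

Lemma sum_words_exchange (I : Type) (s : seq I) (P : pred I) n (F : seq bool -> seq bool -> I -> nat) :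
  \sum_(A <- words n) \sum_(B <- words n) \sum_(j <- s | P j) F A B j =
  \sum_(j <- s | P j) \sum_(A <- words n) \sum_(B <- words n) F A B j.
Proof.
under eq_bigr => A _ do rewrite exchange_big.
by rewrite exchange_big.
Qed.

Lemma s2_123_halves n : s2_123 n =
  \sum_(1 <= i < n) \sum_(1 <= r < i.+1) \sum_(1 <= s < i.+1)
    \sum_(1 <= h < n.+1 | ~~ odd (n - h)) \sum_(0 <= k < n.+1 - 2 * i)
      (\sum_(A <- words n) halfb i r k (n + h)./2 A) *
      (\sum_(B <- words n) halfb i s (n - 2 * i - k) (n + h)./2 B).
Proof.
pose G i := \sum_(1 <= r < i.+1) \sum_(1 <= s < i.+1)
    \sum_(1 <= h < n.+1 | ~~ odd (n - h)) \sum_(0 <= k < n.+1 - 2 * i)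
      (\sum_(A <- words n) halfb i r k (n + h)./2 A) *
      (\sum_(B <- words n) halfb i s (n - 2 * i - k) (n + h)./2 B).
rewrite -/G s2_123_top; transitivity (\sum_(0 <= b < n) G (n - b)).
  rewrite !big_nat; apply: eq_bigr => b /andP[_ bn].
  rewrite card_avoiding sum_words_cat.
  transitivity (\sum_(A <- words n) \sum_(B <- words n)
    \sum_(1 <= r < (n - b).+1) \sum_(1 <= s < (n - b).+1)
      \sum_(1 <= h < n.+1 | ~~ odd (n - h)) \sum_(0 <= k < n.+1 - 2 * (n - b))
        halfb (n - b) r k (n + h)./2 A *
        halfb (n - b) s (n - 2 * (n - b) - k) (n + h)./2 B).
    rewrite big_seq [RHS]big_seq; apply: eq_bigr => A; rewrite mem_words => /eqP sA.
    (* The second half is replaced by its mirror image, so that both halves start at height 0. *)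
    rewrite sum_words_revneg big_seq [RHS]big_seq; apply: eq_bigr => B.
    by rewrite mem_words => /eqP sB; apply: halves_sum.
  rewrite sum_words_exchange; apply: eq_bigr => r _.
  rewrite sum_words_exchange; apply: eq_bigr => s _.
  rewrite sum_words_exchange; apply: eq_bigr => h _.
  rewrite sum_words_exchange; apply: eq_bigr => k _.
  by rewrite big_distrlr.
case: n @G => [|n] G; first by rewrite !big_geq.
(* The index [i = n - b] runs up to the full size; that last term vanishes because its range of [k]
   is empty. *)
rewrite big_nat_rev /= big_nat_recr //= [X in _ + X](_ : _ = 0).
  rewrite addn0 big_add1; apply: eq_big_nat => b /andP[_ bn].
  by congr G; lia.
rewrite /G big1 // => r _; rewrite big1 // => s _; rewrite big1 // => h _.
by rewrite big_geq //; lia.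
Qed.

(** * Closed forms for the final parts *)

Local Open Scope ring_scope.

(* Closed forms of [tails true r u k (u + d)] and [tails false r u k (u + d)]. *)
Definition tails_afterU (r u d k : nat) : int :=
  if k is k'.+1 then
    ('C(u, k) * binp d k')%:Z - (binp (d.+1 - r) k * 'C(u + r.-1, k'))%:Z
  else (d == 0%N)%:Z.

Definition tails_afterD (r u d k : nat) : int :=
  (binp u k * 'C(d, k))%:Z - (binp (d - r) k * 'C(u + r, k))%:Z.

Lemma tails_afterUS r u d k : (0 < r)%N -> (d <= u + r)%N -> (0 < u + d)%N ->
  tails_afterU r u d k =
  (if u is u'.+1 then tails_afterU r.+1 u' d k else 0) +
  (if (d, k) is (d'.+1, k'.+1) then tails_afterD r.-1 u d' k' else 0).
Proof.
case: r => // r _ le; rewrite /tails_afterU /tails_afterD /=.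
case: u le => [|u] le; case: d le => [|d] le // _; case: k => [|k] //=.
- rewrite bin0n /= !subSS !add0n.
  have -> : (d - r = 0)%N by lia.
  have : (d.+1 - r <= 1)%N by lia.
  by case: (d.+1 - r)%N => [|[|?]] //=.
- by rewrite !muln0 !mul0n.
- rewrite !subSS; have [lt|ge] := ltnP d r.
    have -> : (d.+1 - r = 0)%N by lia.
    have -> : (d - r = 0)%N by lia.
    by rewrite /= binS; lia.
  rewrite subSn // binpS binS addSnnS addnS; lia.
Qed.

Lemma tails_afterDS r u d k : (d <= u + r)%N ->
  tails_afterD r u d k =
  (if u is u'.+1 then tails_afterU r.+1 u' d k else 0) +
  (if (d, r) is (d'.+1, r'.+1) then tails_afterD r' u d' k else 0).
Proof.
rewrite /tails_afterU /tails_afterD /=.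
case: u => [|u] le.
  have -> : (d - r = 0)%N by lia.
  case: d le => [|d] le; case: r le => [|r] le //=.
  by have -> : (d - r = 0)%N by lia.
case: k => [|k] /=.
  by case: d le => [|d] le; case: r le => [|r] le; rewrite ?subSS ?bin0 ?subn0 /= ?bin0; lia.
case: d le => [|d] le.
  by rewrite !subSS ?sub0n ?bin0n /= ?muln0 ?mul0n; lia.
case: r le => [|r] le.
  rewrite !subSS !subn0 /= !addn0 !binS !mulnDr; lia.
  rewrite !subSS !addnS !addSn !binS !mulnDr /=; lia.
Qed.

(** For [k >= 1] the first product in [tails_afterU] counts all words by their runs: [d] is split
    into [k] positive parts and [u] into [k + 1] parts, only the first possibly 0. The second
    product corrects for words going below 0. The proof compares first-step recurrences. *)
Lemma tailsE m r u d k : (u + d)%N = m -> (d <= u + r)%N ->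
  (tails false r u k m)%:Z = tails_afterD r u d k /\
  ((0 < r)%N -> (tails true r u k m)%:Z = tails_afterU r u d k).
Proof.
elim: m r u d k => [|m IH] r u d k E le.
  have [-> ->] : u = 0%N /\ d = 0%N by lia.
  rewrite !tails0 /tails_afterD /tails_afterU andbF /=; split => //.
  by case: k => // k; case: r {le} => // r _; rewrite subSS sub0n /= muln0 mul0n.
split=> [|r0]; rewrite tailsS PoszD.
  rewrite tails_afterDS //; congr (_ + _).
    by case: u E le => // u E le; have [_ ->] := IH r.+1 u d k ltac:(lia) ltac:(lia).
  rewrite andbT subn0; case: r le => [|r] le; first by case: d {E le}.
  case: d E le => [|d] E le; last by have [-> _] := IH r u d k ltac:(lia) ltac:(lia).
  rewrite /= /tails big_seq big1 // => w; rewrite mem_words => /eqP sw.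
  by have := count_UD w; rewrite sw; case: (cU w =P u) => [e|_]; rewrite ?andbF //; lia.
rewrite tails_afterUS //; last by lia.
congr (_ + _).
  by case: u E le => // u E le; have [_ ->] := IH r.+1 u d k ltac:(lia) ltac:(lia).
rewrite r0 /=; case: k => [|k]; first by case: d {E le}.
case: d E le => [|d] E le; last by rewrite subSS subn0; have [-> _] := IH r.-1 u d k ltac:(lia) ltac:(lia).
rewrite /= /tails big_seq big1 // => w; rewrite mem_words => /eqP sw.
by have := count_UD w; rewrite sw; case: (cU w =P u) => [e|_]; rewrite ?andbF //; lia.
Qed.

Lemma tails_small b r u k m : (m < u)%N -> tails b r u k m = 0%N.
Proof.
move=> lt; rewrite /tails big_seq big1 // => w; rewrite mem_words => /eqP sw.
by have := count_UD w; rewrite sw; case: (cU w =P u) => [e|_]; rewrite ?andbF //; lia.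
Qed.

Lemma binz_nat (x : int) (m k : nat) : x = m%:Z -> binz x k%:Z = ('C(m, k))%:Z.
Proof. by move=> ->. Qed.

Lemma binz_pred (x : int) (m k : nat) : x = m%:Z - 1 -> binz x k%:Z = (binp m k)%:Z.
Proof. by move=> ->; case: m => [|m] //; have -> : m.+1%:Z - 1 = m%:Z by lia. Qed.

Lemma binz_neg (x y : int) : x < 0 -> binz x y = 0.
Proof. by case: x. Qed.

(** Here [l] is the length of a half-path after its i-th up step, leading from height [r] to [h], so
    [(l + h - r) / 2] and [(l - h + r) / 2] count its up and down steps. The first of these steps is
    the second marked up step, hence the start at [r.+1] and one up step fewer. *)
Lemma fE n i r h e k : (1 <= r <= i)%N -> (1 <= h)%N -> (2 * i <= n)%N ->
  (n + h = 2 * e)%N ->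
  f k%:Z r%:Z h%:Z (n%:Z - 2 * i%:Z + r%:Z) =
  (tails true r.+1 (e - i.+1) k (n - 2 * i + r.-1))%:Z.
Proof.
move=> /andP[r1 ri] h1 in2 E; set l := n%:Z - _ + _.
pose u := (e - i.+1)%N; rewrite -/u.
have half_eq (x y : int) : x = 2 * y -> (x %/ 2)%Z = y by move=> ->; rewrite mulrC mulzK.
have E1 : ((l + h%:Z - r%:Z) %/ 2)%Z = u%:Z + 1 by apply: half_eq; rewrite /l /u; lia.
have E2 : ((l - h%:Z + r%:Z) %/ 2)%Z = e%:Z - i%:Z + r%:Z - h%:Z by apply: half_eq; rewrite /l; lia.
have E3 : ((l - h%:Z - r%:Z) %/ 2)%Z = e%:Z - i%:Z - h%:Z by apply: half_eq; rewrite /l; lia.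
have E4 : ((l + h%:Z + r%:Z) %/ 2)%Z = (u + r)%N%:Z + 1 by apply: half_eq; rewrite /l /u; lia.
rewrite /f E1 E2 E3 E4.
(* With a negative number of down steps no path exists; [f] vanishes by the convention on negative
   upper entries, or by [l <> h - r] when [k = 0]. *)
have [dneg|dpos] := ltnP (e + r) (i + h).
  rewrite tails_small; last by rewrite /u; lia.
  case: k => [|k] /=.
    by rewrite (_ : _ == _ = false) //; apply/eqP; rewrite /l; lia.
  rewrite [binz (e%:Z - _ + _ - _ - 1) _]binz_neg; last by lia.
  by rewrite [binz (e%:Z - _ - _ - 1) _]binz_neg; [rewrite mulr0 mul0r | lia].
pose d := (e + r - (i + h))%N.
have E5 : (u + d = n - 2 * i + r.-1)%N by rewrite /u /d; lia.
have E6 : (d <= u + r.+1)%N by rewrite /u /d; lia.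
have [_ ->] // := tailsE k E5 E6.
rewrite /tails_afterU; case: k => [|k].
  have -> : (l == h%:Z - r%:Z) = (d == 0)%N by apply/eqP/eqP; rewrite /l /d; lia.
  by case: (d == 0)%N.
rewrite (_ : 1 <= k.+1%:Z) //.
have -> : k.+1%:Z - 1 = k%:Z by lia.
have B1 : u%:Z + 1 - 1 = u%:Z by lia.
have B2 : (u + r)%N%:Z + 1 - 1 = (u + r)%N%:Z by lia.
have B3 : e%:Z - i%:Z + r%:Z - h%:Z - 1 = d%:Z - 1 by rewrite /d; lia.
rewrite (binz_nat _ B1) (binz_nat _ B2) (binz_pred _ B3).
rewrite subSS /= !PoszM; congr (_ - _ * _).
(* For [e < i + h] the integer upper entry is negative and [binz] is 0; this agrees with [binp] at
   [d - r], truncated to 0. *)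
have [le|lt] := leqP (i + h) e.
  by apply: binz_pred; rewrite /d; lia.
rewrite binz_neg; last by lia.
by rewrite (_ : (d - r = 0)%N) //; rewrite /d; lia.
Qed.

(** * Assembling the formula over the integers *)

Lemma Posz_sum (I : Type) (s : seq I) (P : pred I) (F : I -> nat) :
  (\sum_(j <- s | P j) F j)%:Z = \sum_(j <- s | P j) (F j)%:Z.
Proof. exact: (big_morph Posz PoszD). Qed.

Lemma ballot_binz i r : (1 <= r <= i)%N ->
  (ballot 0 i.-1 (2 * i - r.+1))%:Z =
  binz (2 * i%:Z - r%:Z - 1) (i%:Z - 1) - binz (2 * i%:Z - r%:Z - 1) i%:Z.
Proof.
move=> /andP[r1 ri]; have := @ballotE 0 i.-1 (i - r) ltac:(lia).
have -> : (i.-1 + (i - r) = 2 * i - r.+1)%N by lia.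
have -> : (i.-1 + 0 + 1 = i)%N by lia.
have E : 2 * i%:Z - r%:Z - 1 = (2 * i - r.+1)%N%:Z by lia.
have E' : i%:Z - 1 = i.-1%:Z by lia.
by rewrite E' !(binz_nat _ E) => <-; rewrite PoszD addrK.
Qed.

(* The range 0 <= k < n.+1 - 2 * i is {0, ..., n - 2i}, and it is empty when
   n < 2i because subtraction on nat is truncated. *)
Theorem theorem3p3 (n : nat) (hn : (1 <= n)%N) :
  (s2_123 n)%:Z =
  \sum_(1 <= i < n) \sum_(1 <= r < i.+1) \sum_(1 <= s < i.+1)
    (binz (2 * i%:Z - r%:Z - 1) (i%:Z - 1) - binz (2 * i%:Z - r%:Z - 1) i%:Z)
    * (binz (2 * i%:Z - s%:Z - 1) (i%:Z - 1) - binz (2 * i%:Z - s%:Z - 1) i%:Z)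
    * (\sum_(1 <= h < n.+1 | ~~ odd (n - h))
         \sum_(0 <= k < n.+1 - 2 * i)
           f k%:Z r%:Z h%:Z (n%:Z - 2 * i%:Z + r%:Z)
           * f (n%:Z - 2 * i%:Z - k%:Z) s%:Z h%:Z (n%:Z - 2 * i%:Z + s%:Z)).
Proof.
rewrite s2_123_halves Posz_sum; apply: eq_bigr => i _.
rewrite Posz_sum big_nat_cond [RHS]big_nat_cond; apply: eq_bigr => r /andP[rr _].
rewrite Posz_sum big_nat_cond [RHS]big_nat_cond; apply: eq_bigr => s /andP[sr _].
rewrite Posz_sum big_distrr /= [LHS]big_nat_cond [RHS]big_nat_cond.
apply: eq_bigr => h /andP[hr o].
rewrite Posz_sum big_distrr /= [LHS]big_nat_cond [RHS]big_nat_cond.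
apply: eq_bigr => k /andP[/andP[_ kr] _].
have E : (n + h = 2 * (n + h)./2)%N.
  rewrite mul2n even_halfK // oddD; move: o.
  by rewrite oddB; [rewrite addbC | lia].
have -> : n%:Z - 2 * i%:Z - k%:Z = (n - 2 * i - k)%N%:Z by lia.
(* A nonempty range of [k] forces [2 * i <= n]; together with [h >= 1] this leaves room for the
   second marked up step. *)
have in2 : (2 * i <= n)%N by lia.
have ie : (i < (n + h)./2)%N by lia.
have h1 : (1 <= h)%N by case/andP: hr.
rewrite (sum_halfb k rr in2 ie) (sum_halfb _ sr in2 ie) !PoszM.
rewrite (fE k rr h1 in2 E) (fE (n - 2 * i - k) sr h1 in2 E).
by rewrite -(ballot_binz rr) -(ballot_binz sr) mulrACA.
Qed.
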